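(* Let $X$ be a compact, metric and totally disconnected space and let $f \colon X \to X$ be a continuous map. Consider the induced map $f_* \colon \check{H}_0(X;\mathbb{C}) \to \check{H}_0(X;\mathbb{C})$ in Čech homology. Then the following statements are equivalent: (i) There exists $\lambda \in \mathbb{C}$ with $|\lambda| \neq 0, 1$ that is not an eigenvalue of $f_*$. (ii) No $\lambda \in \mathbb{C}$ with $|\lambda| \neq 0, 1$ is an eigenvalue of $f_*$. (iii) $(X, f)$ admits dynamical $\epsilon$-partitions for every $\epsilon > 0$.
   Context: For a compact space $Z$, the Čech cohomology group $\check{H}^0(Z;\mathbb{C})$ is identified with the $\mathbb{C}$-vector space of all locally constant maps $\varphi \colon Z \to \mathbb{C}$, and the map $f^*$ induced by a continuous $f \colon Z \to Z$ is $\varphi \mapsto \varphi \circ f$. Čech homology is the dual vector space $\check{H}_0(Z;\mathbb{C}) = \mathrm{Hom}(\check{H}^0(Z;\mathbb{C}),\mathbb{C})$ (all $\mathbb{C}$-linear functionals), and $f_*$ is the dual of $f^*$, i.e. $f_*(T) = T \circ f^*$. A dynamical $\epsilon$-partition $\mathcal U$ of $(X,f)$ is a finite partition of $X$ into clopen (simultaneously closed and open) subsets of diameter smaller than $\epsilon$ such that for every $U \in \mathcal U$ there is $U' \in \mathcal U$ (possibly $U'=U$) with $f(U) \subset U'$. *)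

(* Defs.v *)
From HB Require Import structures.
From mathcomp Require Export all_boot all_order all_algebra.
From mathcomp Require Export all_classical all_reals all_analysis.
From mathcomp Require Export complex.

Set Implicit Arguments.
Unset Strict Implicit.
Unset Printing Implicit Defensive.

Import Order.TTheory GRing.Theory Num.Theory.

Local Open Scope classical_set_scope.
Local Open Scope ring_scope.

(* [vector.leigenvalue] is restricted to finite-dimensional spaces. *)
Definition lin_eigenvalue (K : fieldType) (V : lmodType K)
    (g : {linear V -> V}) (lam : K) : Prop :=
  exists2 v : V, v != 0 & g v = lam *: v.

(* Algebraic dual Hom(V, K): all linear functionals, no continuity required. *)
Definition dual (K : fieldType) (V : lmodType K) : Type := {linear V -> K^o}.

Section DualSpace.
Variables (K : fieldType) (V : lmodType K).

Definition dual_fun (T : dual V) : V -> K^o :=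
  GRing.Linear.sort (T : {linear V -> K^o}).

Lemma dual_ext (S T : dual V) : dual_fun S =1 dual_fun T -> S = T.
Proof.
case: S => s [[s1] [s2]]; case: T => t [[t1] [t2]].
rewrite /dual_fun /= => /funext st.
move: s1 s2 t1 t2; rewrite st => s1 s2 t1 t2.
by rewrite (Prop_irrelevance s1 t1) (Prop_irrelevance s2 t2).
Qed.

HB.instance Definition _ := gen_eqMixin (dual V).
HB.instance Definition _ := gen_choiceMixin (dual V).

Definition dual_zero : dual V := (\0 : V -> K^o).
Definition dual_opp (T : dual V) : dual V := (\- dual_fun T : V -> K^o).
Definition dual_add (S T : dual V) : dual V :=
  (dual_fun S \+ dual_fun T : V -> K^o).
Definition dual_scale (a : K) (T : dual V) : dual V :=
  (a \*: dual_fun T : V -> K^o).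

Fact dual_addA : associative dual_add.
Proof. by move=> S T U; apply: dual_ext => v; rewrite /dual_fun/= addrA. Qed.

Fact dual_addC : commutative dual_add.
Proof. by move=> S T; apply: dual_ext => v; rewrite /dual_fun/= addrC. Qed.

Fact dual_add0 : left_id dual_zero dual_add.
Proof. by move=> T; apply: dual_ext => v; rewrite /dual_fun/= add0r. Qed.

Fact dual_addN : left_inverse dual_zero dual_opp dual_add.
Proof. by move=> T; apply: dual_ext => v; rewrite /dual_fun/= addNr. Qed.

HB.instance Definition _ := GRing.isZmodule.Build (dual V)
  dual_addA dual_addC dual_add0 dual_addN.

Fact dual_scaleA a b T : dual_scale a (dual_scale b T) = dual_scale (a * b) T.
Proof. by apply: dual_ext => v; rewrite /dual_fun/= scalerA. Qed.

Fact dual_scale1 : left_id 1 dual_scale.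
Proof. by move=> T; apply: dual_ext => v; rewrite /dual_fun/= scale1r. Qed.

Fact dual_scaleDr : right_distributive dual_scale +%R.
Proof. by move=> a S T; apply: dual_ext => v; rewrite /dual_fun/= scalerDr. Qed.

Fact dual_scaleDl T : {morph dual_scale^~ T : a b / a + b}.
Proof. by move=> a b; apply: dual_ext => v; rewrite /dual_fun/= scalerDl. Qed.

HB.instance Definition _ := GRing.Zmodule_isLmodule.Build K (dual V)
  dual_scaleA dual_scale1 dual_scaleDr dual_scaleDl.

End DualSpace.

Section DualMap.
Variables (K : fieldType) (V W : lmodType K) (g : {linear V -> W}).

Definition dual_map (T : dual W) : dual V := (dual_fun T \o g : V -> K^o).

Fact dual_map_linear : linear dual_map.
Proof. by move=> a S T; apply: dual_ext. Qed.

HB.instance Definition _ :=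
  GRing.isLinear.Build K (dual W) (dual V) *:%R dual_map dual_map_linear.

End DualMap.

Section CechH0.
Variables (X : topologicalType) (K : fieldType).

Definition locally_constant (phi : X -> K^o) : Prop :=
  forall x : X, \forall y \near x, phi y = phi x.

Definition lconst : {pred X -> K^o} := fun phi => `[< locally_constant phi >].

Fact lconst_submod_closed : submod_closed lconst.
Proof.
split; first by apply/asboolP => x; apply: nearW.
move=> a phi psi /asboolP cphi /asboolP cpsi; apply/asboolP => x.
by have := cpsi x; apply: filterS2 (cphi x) => y /= phiy psiy;
  rewrite !fctE phiy psiy.
Qed.

HB.instance Definition _ := GRing.isSubmodClosed.Build _ _ lconst
  lconst_submod_closed.

(* Cech cohomology of a compact X in degree 0, as the space of locally
   constant functions. *)
Record cech_coh0 : Type :=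
  CechCoh0 { coh0_fun :> X -> K^o ; coh0P : coh0_fun \in lconst }.

HB.instance Definition _ := [isSub for coh0_fun].
HB.instance Definition _ := [Choice of cech_coh0 by <:].
HB.instance Definition _ := [SubChoice_isSubLmodule of cech_coh0 by <:].

(* Cech homology in degree 0, as the dual of the cohomology. *)
Definition cech_hom0 := dual cech_coh0.

HB.instance Definition _ := GRing.Lmodule.on cech_hom0.

End CechH0.

Arguments cech_coh0 : clear implicits.
Arguments cech_hom0 : clear implicits.

Section InducedMaps.
Variables (X : topologicalType) (K : fieldType).
Variables (f : X -> X) (cf : continuous f).

Fact coh0_pull_subproof (phi : cech_coh0 X K) :
  (phi : X -> K^o) \o f \in @lconst X K.
Proof.
case: phi => phi /= /asboolP cphi; apply/asboolP => x.
exact: cf x _ (cphi (f x)).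
Qed.

Definition coh0_pull (phi : cech_coh0 X K) : cech_coh0 X K :=
  CechCoh0 (coh0_pull_subproof phi).

Fact coh0_pull_linear : linear coh0_pull.
Proof. by move=> a phi psi; apply: val_inj; apply: funext. Qed.

HB.instance Definition _ := GRing.isLinear.Build K
  (cech_coh0 X K) (cech_coh0 X K) *:%R coh0_pull coh0_pull_linear.

Definition hom0_push : {linear cech_hom0 X K -> cech_hom0 X K} :=
  dual_map coh0_pull.

End InducedMaps.

Arguments hom0_push {X} K {f} cf.

(* The supremum is taken in the extended reals, so an unbounded set has
   diameter +oo rather than the junk value of [sup]. *)
Definition diam (R : realType) (X : metricType R) (U : set X) : \bar R :=
  ereal_sup [set (mdist x y)%:E | x in U & y in U].

(* [partition] includes the requirement that all members be nonempty. *)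
Definition dynamical_partition (R : realType) (X : metricType R) (f : X -> X)
    (eps : R) (P : set (set X)) : Prop :=
  [/\ finite_set P,
      partition P id [set: X],
      forall U, P U -> clopen U /\ (diam U < eps%:E)%E &
      forall U, P U -> exists2 U', P U' & f @` U `<=` U'].

(* Main.v *)
Require Import Defs.
From HB Require Import structures.
From mathcomp Require Import all_boot all_order all_algebra.
From mathcomp Require Import all_classical all_reals all_analysis.
From mathcomp Require Import complex.
From mathcomp Require Import finmap zify ring lra.

(** Write g for the pull-back phi |-> phi \o f on locally constant functions.
    A functional T satisfies f_* T = lam T exactly when it kills the range of
    g - lam, so lam fails to be an eigenvalue of f_* exactly when g - lam is
    surjective ([separating_functional], [not_eigenvalue_solve]).

    From partitions to eigenvalues: a locally constant phi is constant on the
    members of a fine enough dynamical partition P. As f acts on the finite set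
    P, two iterates f^a and f^b, a < b, send every point to the same member of
    P ([dynamical_partition_iterates]); hence g^a phi = g^b phi, so an
    eigenvector T satisfies lam^a T phi = lam^b T phi, and T phi = 0 when |lam|
    is neither 0 nor 1.

    From one non-eigenvalue lam to partitions: cut X into finitely many small
    clopen pieces, let q x be the piece containing x, and let Y be the two-sided
    subshift whose finite words all occur in the itineraries n |-> q (f^n x)
    ([language]). If every s in Y satisfies s p = s 0, then by compactness the
    itineraries become p-periodic after a common time n, and the itineraries of
    length n + p cut X into the required partition
    ([language_periodic], [periodic_dynamical_partition]).

    It remains to derive this periodicity from the surjectivity of g - lam.
    Surjectivity descends to Y: the equation psi (sigma s) = lam psi s + phi s
    has, for each phi depending on finitely many coordinates, a bounded solution
    psi depending on finitely many coordinates ([language_cohomological]).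
    Indeed a solution on X takes the same value at two points x, y with the same
    itinerary, because psi (f^n x) - psi (f^n y) = lam^n (psi x - psi y) takes
    finitely many values.

    A subshift which is not uniformly periodic contains two points that agree at
    all negative times and differ at time 0 ([periodic_or_asymptotic]). If
    |lam| > 1 this is impossible ([no_asymptotic_pair]). Along such a pair x, y
    the differences d k = psi (sigma^k x) - psi (sigma^k y) vanish far in the
    past and obey d (k + 1) = lam d k + e k, where e k is the corresponding
    difference of phi. If phi is the indicator of a long word of x ending at time
    0, then e k = 0 for k < 0 and e 0 = 1; were e to vanish for a long time after
    0, d would become so large that it had to blow up, against the boundedness of
    psi. So arbitrarily long pasts of x recur in x or y within a bounded delay
    ([past_recurs]), which makes the common past periodic; replacing one of the
    two points by the periodic continuation of that past and applying the same
    argument again gives a contradiction. If |lam| < 1, time reversal exchanges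
    lam with lam^-1. *)

Set Implicit Arguments.
Unset Strict Implicit.
Unset Printing Implicit Defensive.
Import Order.TTheory GRing.Theory Num.Theory.

Local Open Scope classical_set_scope.
Local Open Scope ring_scope.
Local Open Scope complex_scope.

Local Notation modulus := (@Normc.normc _).

(** * Subshifts *)

Lemma nat_pigeonhole (T : finType) (h : nat -> T) :
  exists a b : nat, [/\ (a < b)%N, (b <= #|T|)%N & h a = h b].
Proof.
pose g (i : 'I_#|T|.+1) := h i.
have /injectivePn [i [j ij gij]] : ~~ injectiveb g.
  apply/negP => /injectiveP /leq_card; by rewrite card_ord ltnn.
case: (ltngtP i j) => [lij|lji|/val_inj eij].
- by exists i, j; split => //; rewrite -ltnS.
- by exists j, i; split => //; rewrite -ltnS.
- by rewrite eij eqxx in ij.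
Qed.

(** Failure of every t at some level M t would refute all of them at the largest
    such level. *)
Lemma antitone_pigeonhole (T : finType) (Q : nat -> T -> Prop) :
  (forall m n t, (m <= n)%N -> Q n t -> Q m t) ->
  (forall m, exists t, Q m t) -> exists t, forall m, Q m t.
Proof.
move=> Qanti Qex; apply: contrapT => /forallNP noQ.
have {noQ} /choice [M MP] : forall t, exists m, ~ Q m t.
  by move=> t; apply/existsNP.
have [t Qt] := Qex (\max_t M t).
by apply: (MP t); apply: Qanti Qt; exact: leq_bigmax.
Qed.

Definition shift (F : Type) (k : int) (s : int -> F) : int -> F :=
  fun i => s (i + k).

Definition agree (F : Type) (m : nat) (s t : int -> F) :=
  forall i : int, `|i| <= m%:Z -> s i = t i.

(** Sequential compactness of the full shift: each coordinate takes one of its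
    finitely many values along a fixed nonprincipal ultrafilter, and finitely
    many coordinates are handled at once by intersection. *)
Lemma limit_point (F : finType) (u : nat -> int -> F) :
  exists s, forall m n0, exists2 n, (n0 <= n)%N & agree m s (u n).
Proof.
have [U [UU oU]] := @ultraFilterLemma _ \oo _.
have lab i : exists a, U [set n | u n i = a].
  apply: contrapT => /forallNP nU.
  have : U [set n | forall a, u n i <> a].
    apply: filter_forall => a.
    have [|//] := in_ultra_setVsetC [set n | u n i = a] UU.
    by move/nU.
  by move=> /filter_ex [n] /(_ (u n i)).
have [s sP] := choice lab; exists s => m n0.
have : U ([set n | forall i : 'I_m.+1, u n i%:Z = s i%:Z] `&`
  [set n | forall i : 'I_m.+1, u n (- i%:Z) = s (- i%:Z)] `&`
  [set n | (n0 <= n)%N]).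
  apply: filterI; last by apply: oU; exact: nbhs_infty_ge.
  by apply: filterI; apply: filter_forall => i; exact: sP.
move=> /filter_ex [n [[/= npos nneg] n0n]]; exists n => // i im.
case: (intP i) im => [|k|k] im; symmetry.
- exact: (npos ord0).
- have km : (k.+1 < m.+1)%N by lia.
  exact: (npos (Ordinal km)).
- have km : (k.+1 < m.+1)%N by lia.
  exact: (nneg (Ordinal km)).
Qed.

Lemma limit_pair (F : finType) (u v : nat -> int -> F) :
  exists s t, forall m n0, exists n,
    [/\ (n0 <= n)%N, agree m s (u n) & agree m t (v n)].
Proof.
have [w wP] := limit_point (fun n i => (u n i, v n i)).
exists (fun i => (w i).1), (fun i => (w i).2) => m n0.
have [n n0n wn] := wP m n0.
by exists n; split => // i im; rewrite wn.
Qed.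

Section Subshift.
Variable F : finType.
Implicit Types (s t : int -> F) (Y : set (int -> F)).

(** The first clause is closedness in the product topology. *)
Definition subshift Y :=
  (forall s, (forall m, exists2 t, Y t & agree m s t) -> Y s) /\
  (forall k s, Y s -> Y (shift k s)).

Lemma shiftD k l s : shift k (shift l s) = shift (l + k) s.
Proof. by apply: funext => i; rewrite /shift; congr s; ring. Qed.

(** Without an asymptotic pair, compactness bounds the length n of past needed to
    determine the next letter. Each point is then driven by a deterministic
    automaton on words of length n, so it is periodic from time w on, where w is
    the number of words, with a period dividing w!. *)
Lemma periodic_or_asymptotic Y : subshift Y ->
  (exists2 p, (0 < p)%N & forall s, Y s -> s p%:Z = s 0) \/
  (exists x y, [/\ Y x, Y y, x 0 <> y 0 & forall i : int, i < 0 -> x i = y i]).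
Proof.
move=> [Yclosed Yshift]; set asym := (X in _ \/ X).
case: (pselect asym) => [|noasym]; first by right.
left; have [n nP] : exists n : nat, forall x y, Y x -> Y y ->
    (forall i : int, - n%:Z <= i < 0 -> x i = y i) -> x 0 = y 0.
  apply: contrapT => /forallNP nex; apply: noasym.
  have {nex} /choice [w wP] : forall n : nat, exists w : (int -> F) * (int -> F),
      [/\ Y w.1, Y w.2, forall i : int, - n%:Z <= i < 0 -> w.1 i = w.2 i &
        w.1 0 <> w.2 0].
    move=> n; have /existsNP [x /existsNP [y /not_implyP [Yx /not_implyP [Yy
      /not_implyP [xy nxy]]]]] := nex n.
    by exists (x, y).
  have [x [y xyP]] := limit_pair (fun n => (w n).1) (fun n => (w n).2).
  exists x, y; split.
  - apply: Yclosed => m; have [n [_ xn _]] := xyP m 0%N.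
    by exists (w n).1 => //; have [] := wP n.
  - apply: Yclosed => m; have [n [_ _ yn]] := xyP m 0%N.
    by exists (w n).2 => //; have [] := wP n.
  - have [n [_ xn yn]] := xyP 0%N 0%N.
    by rewrite xn ?yn //; have [] := wP n.
  - move=> i i0; have [n [nle xn yn]] := xyP `|i|%N `|i|%N.
    have [_ _ wi _] := wP n.
    by rewrite xn ?yn ?wi //; lia.
(* n consecutive letters determine the whole future. *)
have det x y : Y x -> Y y -> (forall i : int, 0 <= i < n%:Z -> x i = y i) ->
    forall i : nat, x i%:Z = y i%:Z.
  move=> Yx Yy xy; elim/ltn_ind => i IH.
  have [ltin|lein] := ltnP i n; first by apply: xy; lia.
  have := nP _ _ (Yshift i%:Z _ Yx) (Yshift i%:Z _ Yy).
  rewrite /shift !add0r; apply => j jn.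
  have -> : j + i%:Z = Posz (absz (j + i%:Z)) by lia.
  by apply: IH; lia.
pose W := {ffun 'I_n -> F}.
exists (#|W|)`!; first exact: fact_gt0.
(* Starting the orbit at time - w makes the preperiod end before time 0. *)
move=> s Ys; pose t := shift (- #|W|%:Z) s.
have Yt : Y t by exact: Yshift.
pose h (k : nat) : W := [ffun j : 'I_n => t (k + j)%N%:Z].
have [a [b [ltab leb hab]]] := nat_pigeonhole h.
set w := #|W|; have {}leb : (b <= w)%N := leb.
have tper (i : nat) : t (a + i)%N%:Z = t (b + i)%N%:Z.
  have := det _ _ (Yshift a%:Z _ Yt) (Yshift b%:Z _ Yt).
  rewrite /shift !(addnC _ i) => /(_ _ i); apply => j jn.
  have jn' : (`|j| < n)%N by lia.
  move/ffunP/(_ (Ordinal jn')): hab; rewrite !ffunE /=.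
  have -> : Posz (a + `|j|)%N = j + a by lia.
  by have -> : Posz (b + `|j|)%N = j + b by lia.
have tmul (i c : nat) : (a <= i)%N -> t (i + c * (b - a))%N%:Z = t i%:Z.
  move=> ai; elim: c => [|c IH]; first by rewrite mul0n addn0.
  rewrite mulSn -IH; move: (c * (b - a))%N => e.
  have := tper (i + e - a)%N.
  have -> : (a + (i + e - a) = i + e)%N by lia.
  by have -> : (b + (i + e - a) = i + (b - a + e))%N by lia.
have /dvdnP [c cE] : (b - a %| (w)`!)%N by apply: dvdn_fact; lia.
have := tmul w c; rewrite -cE /t /shift => /(_ _).
have -> : w%:Z - w%:Z = 0 by ring.
by rewrite PoszD addrAC subrr add0r; apply; lia.
Qed.

End Subshift.

(** * Growth of moduli *)

Lemma bernoulli_ineq (R : realDomainType) (L : R) (n : nat) :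
  1 <= L -> 1 + n%:R * (L - 1) <= L ^+ n.
Proof.
move=> L1; elim: n => [|n IH]; first by rewrite mul0r addr0 expr0.
rewrite exprS -[n.+1]add1n natrD.
have := mulr_ge0 (ler0n R n) (sqr_ge0 (L - 1)); rewrite expr2.
have : L * (1 + n%:R * (L - 1)) <= L * L ^+ n by rewrite ler_wpM2l //; lra.
by move: (n%:R : R) (L ^+ n) => a b; lra.
Qed.

Lemma expr_unbounded (R : archiRealFieldType) (L B : R) :
  1 < L -> exists n, B < L ^+ n.
Proof.
move=> L1; have L10 : 0 < L - 1 by rewrite subr_gt0.
pose n := Num.trunc (`|B| / (L - 1)); exists n.+1.
have := bernoulli_ineq n.+1 (ltW L1); apply: lt_le_trans.
have : `|B| / (L - 1) < n.+1%:R by apply: truncnS_gt.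
rewrite ltr_pdivrMr // => Bn.
by have := ler_norm B; lra.
Qed.

(** (L - 1)^-1 is the fixed point of D |-> L D - 1; above it the distance to the
    fixed point is multiplied by at least L at each step. *)
Lemma bounded_affine_growth (R : archiRealFieldType) (L B : R) (D : nat -> R) :
  1 < L -> (forall n, L * D n - 1 <= D n.+1) -> (forall n, D n <= B) ->
  D 0%N <= (L - 1)^-1.
Proof.
move=> L1 DS DB; rewrite leNgt; apply/negP => cD.
have L10 : 0 < L - 1 by rewrite subr_gt0.
set c := (L - 1)^-1 in cD.
have cE : L * c - 1 = c.
  by rewrite /c; field; rewrite gt_eqF.
have grow n : L ^+ n * (D 0%N - c) <= D n - c.
  elim: n => [|n IH]; first by rewrite mul1r.
  have := DS n; have : L * (L ^+ n * (D 0%N - c)) <= L * (D n - c).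
    by rewrite ler_wpM2l //; lra.
  by rewrite exprS -mulrA; lra.
have [n] := expr_unbounded ((B - c) / (D 0%N - c)) L1.
rewrite ltr_pdivrMr ?subr_gt0 // => Bn.
by have := grow n; have := DB n; lra.
Qed.

Section ComplexModulus.
Variable R : realType.
Implicit Types z w : R[i].

Lemma modulusE z : `|z| = (modulus z)%:C.
Proof. by case: z. Qed.

Lemma modulus_le1 z : (`|z| <= 1) = (modulus z <= 1).
Proof. by rewrite modulusE lecR. Qed.

Lemma modulusB z w : modulus (z - w) <= modulus z + modulus w.
Proof. by rewrite -lecR rmorphD /= -!modulusE; exact: ler_normB. Qed.

Lemma modulusX z n : modulus (z ^+ n) = modulus z ^+ n.
Proof.
by elim: n => [|n IH]; rewrite ?expr0 ?Normc.normc1 // !exprS Normc.normcM IH.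
Qed.

End ComplexModulus.

(** * Rigidity of subshifts on which the cohomological equation is solvable *)

Section Rigidity.
Variables (R : realType) (F : finType).
Implicit Types (s t x y : int -> F) (Y : set (int -> F)) (lam : R[i]).

(** The functions phi and psi stand for locally constant functions on the
    subshift Y: they depend on a finite window of coordinates. Boundedness, which
    the finiteness of F would give, is kept explicit because it is the form in
    which the estimates need it. *)
Definition cohomological_solvable lam Y := forall (phi : (int -> F) -> R[i]) m,
  (forall s t, agree m s t -> phi s = phi t) ->
  exists (psi : (int -> F) -> R[i]) (B : R) N,
    [/\ forall s, Y s -> modulus (psi s) <= B,
        forall s t, Y s -> Y t -> agree N s t -> psi s = psi t &
        forall s, Y s -> psi (shift 1 s) = lam * psi s + phi s].

(** The delay j is at most J, where |lam|^J exceeds the threshold (|lam| - 1)^-1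
    beyond which a solution cannot stay bounded. For each M, the word of x on
    [- M, 0] must recur with some delay in [1, J], in x or in y; as there are
    finitely many choices, one of them serves all M. *)
Lemma past_recurs Y lam x y : subshift Y -> cohomological_solvable lam Y ->
  1 < modulus lam -> Y x -> Y y -> x 0 <> y 0 ->
  (forall i : int, i < 0 -> x i = y i) ->
  exists z (j : nat), [/\ (0 < j)%N, z = x \/ z = y &
    forall i : int, i <= 0 -> z (i + j%:Z) = x i].
Proof.
move=> [_ Yshift] Ylam lam1 Yx Yy xy0 xy.
have [J cJ] := expr_unbounded (modulus lam - 1)^-1 lam1.
pose Q (M : nat) (c : bool * 'I_J) := forall i : int, - M%:Z <= i <= 0 ->
  (if c.1 then x else y) (i + c.2.+1%:Z) = x i.
suff [[b j] bjP] : exists c, forall M, Q M c.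
  exists (if b then x else y), j.+1; split => //; first by case: b {bjP}; [left|right].
  by move=> i i0; apply: (bjP `|i|%N); lia.
apply: antitone_pigeonhole => [m n c mn Qn i im|M]; first by apply: Qn; lia.
apply: contrapT => /forallNP noQ.
pose occurs s := forall i : int, - M%:Z <= i <= 0 -> s i = x i.
pose phi s : R[i] := if `[< occurs s >] then 1 else 0.
have phiM s t : agree M s t -> phi s = phi t.
  move=> st; rewrite /phi; congr (if _ then _ else _).
  by apply: asbool_equiv_eq; split => o i iM; rewrite -(o i iM) st //; lia.
have [psi [B [N [psiB psiN psiS]]]] := Ylam phi M phiM.
(* The recurrence started in the remote past, where x and y agree on the window
   of psi, gives d 0 = 0; a vanishing e on [1, J] gives d (1 + J) = lam ^ J. *)
pose d (k : int) := psi (shift k x) - psi (shift k y).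
pose e (k : int) := phi (shift k x) - phi (shift k y).
have dS k : d (k + 1) = lam * d k + e k.
  rewrite /d /e -(shiftD 1 k x) -(shiftD 1 k y).
  rewrite !psiS; [by ring|exact: Yshift|exact: Yshift].
have e_neg (k : int) : k < 0 -> e k = 0.
  move=> k0; apply/eqP; rewrite subr_eq0; apply/eqP.
  rewrite /phi; congr (if _ then _ else _).
  by apply: asbool_equiv_eq; split => o i iM; rewrite -(o i iM) /shift xy //; lia.
have d_neg (n : nat) : (n <= N.+1)%N -> d (n%:Z - N.+1%:Z) = 0.
  elim: n => [_|n IH nN].
    apply/eqP; rewrite subr_eq0; apply/eqP; apply: psiN; do ?exact: Yshift.
    by move=> i iN; rewrite /shift xy //; lia.
  have -> : n.+1%:Z - N.+1%:Z = n%:Z - N.+1%:Z + 1 by lia.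
  by rewrite dS IH ?(ltnW nN) // e_neg ?mulr0 ?addr0 //; lia.
have d0 : d 0 = 0 by rewrite -(d_neg N.+1) // subrr.
have e0 : e 0 = 1.
  rewrite /e /phi; case: asboolP => [_|[]]; last by move=> i _; rewrite /shift addr0.
  case: asboolP => [/(_ 0)|_]; last by rewrite subr0.
  by rewrite /shift addr0 => /(_ _) yx; case: xy0; rewrite yx //; lia.
have d_pos (j : nat) : (j <= J)%N -> d (1 + j%:Z) = lam ^+ j.
  elim: j => [_|j IH jJ].
    by rewrite addr0 -[X in d X]add0r dS d0 e0 mulr0 add0r.
  have -> : 1 + j.+1%:Z = 1 + j%:Z + 1 by lia.
  rewrite dS IH ?(ltnW jJ) // exprS.
  have nQ b : ~ occurs (shift (1 + j%:Z) (if b then x else y)).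
    move=> o; apply: (noQ (b, Ordinal jJ)) => i iM /=.
    by rewrite -(o i iM) /shift; case: b {o}; congr (_ _); lia.
  rewrite /e /phi; case: asboolP => [/(nQ true)//|_].
  by case: asboolP => [/(nQ false)//|_]; rewrite subr0 addr0.
have e_le1 k : modulus (e k) <= 1.
  rewrite /e /phi -modulus_le1.
  by do 2 case: ifP => _; rewrite ?subrr ?subr0 ?sub0r ?normrN ?normr1 ?normr0.
have := @bounded_affine_growth _ (modulus lam) (B + B)
  (fun n => modulus (d (1 + J%:Z + n%:Z))) lam1.
rewrite addr0 d_pos // modulusX leNgt cJ => H.
suff : false by []; apply: H => n.
  rewrite intS (addrC 1 n%:Z) addrA dS.
  set k := _ + n%:Z; have := modulusB (lam * d k + e k) (e k).
  by rewrite addrK Normc.normcM; have := e_le1 k; lra.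
apply: le_trans (modulusB _ _) _.
by apply: lerD; apply: psiB; exact: Yshift.
Qed.
(** The first recurrence makes the common past of x and y p-periodic; u is its
    periodic continuation, a limit of backward shifts of x. Whichever of x and y
    differs from u at time 0 is called v. The recurrence for the pair v, u gives
    a second period q of the past, and two periods of a left-infinite word
    produce the same continuation; so the recurring point w is u, and u having
    both periods everywhere forces v 0 = u 0. *)
Lemma no_asymptotic_pair Y lam x y : subshift Y -> cohomological_solvable lam Y ->
  1 < modulus lam -> Y x -> Y y -> (forall i : int, i < 0 -> x i = y i) ->
  x 0 = y 0.
Proof.
move=> Ysub Ylam lam1 Yx Yy xy; apply: contrapT => xy0.
have [z [p [p0 zxy zp]]] := past_recurs Ysub Ylam lam1 Yx Yy xy0 xy.
have zx (i : int) : i < 0 -> z i = x i by case: zxy => ->// i0; rewrite xy.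
have xp (i : int) (n : nat) : i < 0 -> x (i - n%:Z * p%:Z) = x i.
  move=> i0; elim: n => [|n IH]; first by rewrite mul0r subr0.
  rewrite -IH -zp; last by nia.
  by rewrite zx; [congr x|]; lia.
(* Any number of periods reaching back to negative times would do. *)
pose u (i : int) := x (i - `|i|%N.+1%:Z * p%:Z).
have uE (i : int) (n : nat) : i - n%:Z * p%:Z < 0 -> u i = x (i - n%:Z * p%:Z).
  move=> in0; rewrite /u.
  rewrite -(xp (i - n%:Z * p%:Z) `|i|%N.+1 in0) -[LHS](xp _ n); last by nia.
  by congr x; ring.
have ux (i : int) : i < 0 -> u i = x i by move=> i0; exact: xp.
have Yu : Y u.
  have [Yclosed Yshift] := Ysub; apply: Yclosed => m.
  exists (shift (- (m.+1%:Z * p%:Z)) x); first exact: Yshift.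
  by move=> i im; rewrite (uE _ m.+1) //; nia.
have [v [Yv vu0 vx]] : exists v, [/\ Y v, v 0 <> u 0 &
    forall i : int, i < 0 -> v i = x i].
  have [xu0|] := pselect (x 0 = u 0); last by move=> ?; exists x.
  by exists y; split; [|rewrite -xu0; exact: nesym|move=> i i0; rewrite xy].
have vu (i : int) : i < 0 -> v i = u i by move=> i0; rewrite vx ?ux.
have [w [q [q0 wvu wq]]] := past_recurs Ysub Ylam lam1 Yv Yu vu0 vu.
have wx (i : int) : i < 0 -> w i = x i.
  by case: wvu => -> // i0; [exact: vx|exact: ux].
have xq (i : int) : i + q%:Z < 0 -> x (i + q%:Z) = x i.
  by move=> iq; rewrite -wx // wq ?vx //; lia.
have w0 : w 0 = u 0.
  have := wq (- q%:Z); rewrite addNr => ->; last by lia.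
  rewrite vx; last by lia.
  rewrite (uE 0 1%N) ?mul1r ?sub0r; last by lia.
  have := xq (- p%:Z - q%:Z); rewrite subrK => ->; last by lia.
  by rewrite -(xp (- q%:Z) 1%N) ?mul1r; [congr x; ring|lia].
have {}wvu : w = u by case: wvu w0 => -> // /vu0.
apply: vu0; have := wq 0 (lexx _); rewrite add0r wvu => <-.
rewrite (uE _ q.+1); last by nia.
rewrite (uE 0 q.+1); last by nia.
by rewrite -(xq (0 - q.+1%:Z * p%:Z)); [congr x; ring|nia].
Qed.

Definition reversal s : int -> F := fun i => s (- i).

Lemma reversalK s : reversal (reversal s) = s.
Proof. by apply: funext => i; rewrite /reversal opprK. Qed.

Lemma reversal_shift k s : reversal (shift k s) = shift (- k) (reversal s).
Proof. by apply: funext => i; rewrite /reversal /shift opprD opprK. Qed.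

Lemma agree_reversal m s t : agree m s t -> agree m (reversal s) (reversal t).
Proof. by move=> st i im; rewrite /reversal st ?normrN. Qed.

Lemma reversal_subshift Y : subshift Y -> subshift (Y \o reversal).
Proof.
move=> [Yclosed Yshift]; split => [s sY|k s Ys] /=.
  apply: Yclosed => m; have [t Yt st] := sY m.
  by exists (reversal t) => //; exact: agree_reversal.
by rewrite reversal_shift; exact: Yshift.
Qed.

(** Solving psi (sigma s) = lam psi s + phi s for psi s expresses it through
    psi (sigma s), which is the same equation with lam^-1 in reversed time; the
    datum must be shifted by one step and multiplied by - lam. *)
Lemma reversal_cohomological lam Y : subshift Y -> lam != 0 ->
  cohomological_solvable lam Y -> cohomological_solvable lam^-1 (Y \o reversal).
Proof.
move=> [_ Yshift] lam0 Ylam phi m phim.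
pose phi' s := - lam * phi (reversal (shift 1 s)).
have phi'm s t : agree m.+1 s t -> phi' s = phi' t.
  move=> st; rewrite /phi'; congr (_ * _); apply: phim; apply: agree_reversal.
  by move=> i im; rewrite /shift st //; lia.
have [psi [B [N [psiB psiN psiS]]]] := Ylam phi' _ phi'm.
exists (psi \o reversal), B, N; split => [s Ys|s t Ys Yt st|s Ys] /=.
- exact: psiB.
- by apply: psiN => //; exact: agree_reversal.
- have := psiS (reversal (shift 1 s)).
  rewrite /phi' reversal_shift shiftD addNr.
  have -> : shift 0 (reversal s) = reversal s.
    by apply: funext => i; rewrite /shift addr0.
  rewrite reversalK => ->; last exact: Yshift.
  by rewrite mulrDr !mulrA mulrN mulVf // mul1r mulN1r subrK.
Qed.

Lemma cohomological_periodic Y lam : subshift Y -> cohomological_solvable lam Y ->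
  modulus lam != 0 -> modulus lam != 1 ->
  exists2 p, (0 < p)%N & forall s, Y s -> s p%:Z = s 0.
Proof.
move=> Ysub Ylam nlam0 nlam1.
have [lam1|lam1|/eqP] := ltgtP (modulus lam) 1; last by rewrite (negbTE nlam1).
  have lam0 : lam != 0 by apply: contra_neq nlam0 => ->; rewrite Normc.normc0.
  have Yrev := reversal_subshift Ysub.
  have [[p p0 pP]|[x [y [Yx Yy xy0 past]]]] :=
    periodic_or_asymptotic Yrev.
    exists p => // s Ys; have [_ Yshift] := Ysub.
    have := pP (reversal (shift p%:Z s)).
    rewrite /= reversalK /reversal /shift addNr oppr0 add0r => -> //.
    exact: Yshift.
  have Yrevlam := reversal_cohomological Ysub lam0 Ylam.
  case: xy0; apply: (no_asymptotic_pair Yrev Yrevlam _ Yx Yy past).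
  rewrite Normc.normcV invf_gt1 // lt_neqAle eq_sym nlam0 /=.
  by rewrite -ler0c -modulusE.
case: (periodic_or_asymptotic Ysub) => [//|[x [y [Yx Yy xy0 past]]]].
case: xy0; exact: (no_asymptotic_pair Ysub Ylam lam1 Yx Yy past).
Qed.

End Rigidity.

(** * Clopen labellings of compact totally disconnected spaces *)

Definition quasi_component (T : topologicalType) (x : T) : set T :=
  [set y | forall C, clopen C -> C x -> C y].

(** Otherwise the traces on K of the clopen neighbourhoods of x form a filter
    base, and a cluster point of it lies in K and in each of those neighbourhoods. *)
Lemma quasi_component_avoids (T : topologicalType) (x : T) (K : set T) :
  compact [set: T] -> closed K -> quasi_component x `&` K = set0 ->
  exists2 C, clopen C /\ C x & C `&` K = set0.
Proof.
move=> cT cK QK; apply: contrapT => noC.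
pose G := filter_from [set D : set T | clopen D /\ D x] (fun D => D `&` K).
have GF : ProperFilter G.
  apply: filter_from_proper; last first.
    move=> D [cD Dx]; apply/set0P/eqP => DK0; apply: noC.
    by exists D.
  apply: filter_from_filter; first by exists setT; split => //; exact: clopenT.
  move=> A B [cA Ax] [cB Bx]; exists (A `&` B).
    by split; [exact: clopenI|split].
  by rewrite setIACA setIid.
have [|z [_ zG]] := cT G GF; first exact: filterT.
have zK : K z.
  apply: cK => V zV; apply: zG => //.
  by exists setT; [split => //; exact: clopenT|move=> ? []].
have : (quasi_component x `&` K) z.
  split => // C cC Cx; apply: (cC.2) => V zV; apply: zG => //.
  by exists C => // ? [].
by rewrite QK.
Qed.

(** Two disjoint closed pieces A, B of the quasi-component have disjoint open
    neighbourhoods U, V by normality (where R provides the values of Urysohn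
    functions). Some clopen C around x avoids the complement of U `|` V, so
    C `&` U is clopen and swallows the whole quasi-component. *)
Lemma quasi_component_connected (R : realType) (T : topologicalType) (x : T) :
  hausdorff_space T -> compact [set: T] -> connected (quasi_component x).
Proof.
move=> hT cT; pose Q := quasi_component x.
have Qx : Q x by [].
have cQ : closed Q.
  move=> y Qy C cC Cx; apply: (cC.2) => V yV.
  by have [z [Qz Vz]] := Qy V yV; exists z; split => //; exact: Qz.
have split_clopen A B : closed A -> closed B -> A `&` B = set0 ->
    Q `<=` A `|` B -> A x -> Q `<=` A.
  move=> cA cB AB QAB Ax.
  have /(@normal_openP R)/(_ A B cA cB AB) [U [V [oU oV AU BV UV]]] :=
    compact_normal hT cT.
  have [||C [cC Cx] CK] := @quasi_component_avoids _ x (~` (U `|` V)) cT.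
  - exact/open_closedC/openU.
  - rewrite -subset0 => y [/QAB [/AU|/BV] ? ]; apply; [by left|by right].
  have CUV : C `<=` U `|` V.
    by move=> y Cy; apply: contrapT => nUV; suff : set0 y by []; rewrite -CK.
  have clU : clopen (C `&` U).
    split; first exact: openI cC.1 oU.
    have -> : C `&` U = C `&` ~` V.
      apply/seteqP; split => y [Cy] yUV; split => //.
        by move=> Vy; suff : set0 y by []; rewrite -UV.
      by case: (CUV y Cy).
    by apply: closedI; [exact: cC.2|exact: open_closedC].
  move=> y Qy; have [//|By] := QAB y Qy.
  have [_ Uy] := Qy _ clU (conj Cx (AU _ Ax)).
  suff : (U `&` V) y by rewrite UV.
  by split => //; exact: BV.
move=> A [a Aa] [W oW AW] [K cK AK].
have AQ : A `<=` Q by rewrite AW => ? [].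
pose B := Q `&` ~` W.
have cA : closed A by rewrite AK; exact: closedI.
have cB : closed B by apply: closedI => //; exact: open_closedC.
have AB : A `&` B = set0 by rewrite AW -subset0 => y [[_ Wy] [_ /(_ Wy)]].
have QAB : Q `<=` A `|` B.
  move=> y Qy; have [Wy|nWy] := pselect (W y); [left|right] => //.
  by rewrite AW.
have [Ax|Bx] := QAB x Qx.
  by apply/seteqP; split; [exact: AQ|exact: (split_clopen A B)].
have QB : Q `<=` B.
  by apply: (split_clopen B A) => //; [rewrite setIC|rewrite setUC].
suff : (A `&` B) a by rewrite AB.
by split; [exact: Aa|exact: QB (AQ _ Aa)].
Qed.

Lemma compact_zero_dimensional (R : realType) (T : topologicalType) :
  hausdorff_space T -> compact [set: T] -> totally_disconnected [set: T] ->
  zero_dimensional T.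
Proof.
move=> hT cT tdT x y xy; apply: contrapT => noC.
have : connected_component [set: T] x y.
  apply: (@connected_component_max _ _ (quasi_component x)) => //.
    exact: (quasi_component_connected R).
  move=> C cC Cx; apply: contrapT => nCy; apply: noC.
  by exists C.
by rewrite tdT // => /esym/eqP; rewrite (negbTE xy).
Qed.

Section Labellings.
Variables (R : realType) (X : metricType R).
Hypotheses (compactX : compact [set: X])
  (tdX : totally_disconnected [set: X]).

(** The same condition as [locally_constant], for values in an arbitrary type. *)
Definition loc_const (T : Type) (phi : X -> T) :=
  forall x : X, \forall y \near x, phi y = phi x.

(** Finitely many clopen sets inside balls of radius eps / 2 cover X; a point is
    labelled by the first one that contains it. *)
Lemma fine_labelling (eps : R) : 0 < eps -> exists k (q : X -> 'I_k.+1),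
  loc_const q /\ forall x y, q x = q y -> mdist x y < eps.
Proof.
move=> eps0; have hX := @metric_hausdorff R X.
have zX := compact_zero_dimensional R hX compactX tdX.
have /choice [C CP] : forall x : X, exists C, [/\ clopen C, C x &
    C `<=` ball x (eps / 2)].
  move=> x; have := zero_dimensional_cvg hX zX compactX.
  move=> /(_ x _ (nbhsx_ballx x _ (divr_gt0 eps0 (ltr0Sn R 1)))).
  by case=> C [Cx cC] Cb; exists C.
have [D Dcov] : exists D : {fset X}, forall x, exists2 c, c \in D & C c x.
  pose large := filter_from [set: {fset X}] (fun D => [set E | D `<=` E]%fset).
  have largeF : ProperFilter large.
    apply: filter_from_proper; last by move=> D _; exists D => /=.
    apply: filter_from_filter; first by exists fset0.
    move=> D E _ _; exists (D `|` E)%fset => // G /= DEG.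
    by split; apply: fsubset_trans DEG; [exact: fsubsetUl|exact: fsubsetUr].
  have /compact_near_coveringP := compactX.
  move=> /(_ _ large (fun D x => exists2 c, c \in D & C c x)) [|D _ DP].
  - move=> x _; have [cC Cx _] := CP x.
    exists (C x, [set D : {fset X} | x \in D]); last by move=> [y D] [/= Cy xD]; exists x.
    split; first by apply: open_nbhs_nbhs; split => //; exact: cC.1.
    exists [fset x]%fset => // D /= /fsubsetP; apply.
    by rewrite inE.
  - by exists D => x; apply: (DP D) => //=.
(* The default value of find, the length of the list, is never attained. *)
pose h x := find (fun c => `[< C c x >]) (enum_fset D).
have hD x : (h x < size (enum_fset D))%N.
  have [c cD Ccx] := Dcov x.
  by rewrite -has_find; apply/hasP; exists c => //; exact/asboolP.
exists (size (enum_fset D)), (fun x => inord (h x)); split => [x|x y].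
  have : \forall y \near x, (\bigcap_(c in [set` D]) [set y | C c y <-> C c x]) y.
    apply: filter_bigI => c _; have [cC _ _] := CP c.
    have [Cx|nCx] := pselect (C c x).
      have : nbhs x (C c) by apply: open_nbhs_nbhs; split => //; exact: cC.1.
      by apply: filterS => y.
    have : nbhs x (~` C c).
      by apply: open_nbhs_nbhs; split => //; exact: (clopenC setT cC).1.
    by apply: filterS => y.
  apply: filterS => y yP; congr inord; apply: eq_in_find => c cD.
  by apply: asbool_equiv_eq; exact: yP.
have hS z : (h z < (size (enum_fset D)).+1)%N by exact: leqW (hD z).
move=> /(congr1 val); rewrite /= !inordK // => hxy.
have memC z : C (nth x (enum_fset D) (h z)) z.
  by apply/asboolP; apply: (@nth_find _ x (fun c => `[< C c z >])); rewrite has_find; exact: hD.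
have := memC y; have := memC x; rewrite -hxy.
set c := nth _ _ _ => Cx Cy; have [_ _ Cb] := CP c.
have /Cb := Cx; have /Cb := Cy; rewrite ballEmdist /= => cy cx.
by apply: (le_lt_trans (metric_triangle x c y)); rewrite (metric_sym x c); lra.
Qed.

(** Lebesgue number of the cover of X by open sets on which phi is constant. *)
Lemma loc_const_uniform (T : Type) (phi : X -> T) : loc_const phi ->
  exists2 delta : R, 0 < delta & forall x y, mdist x y < delta -> phi x = phi y.
Proof.
move=> cphi; have /compact_near_coveringP := compactX.
move=> /(_ R 0^'+ (fun d x => forall y, mdist x y < d -> phi x = phi y)).
case.
  move=> x _; have /nbhs_ballP [r /= r0 rP] := cphi x.
  exists (ball x (r / 2), [set d | d < r / 2]).
    split; first by apply: nbhsx_ballx; rewrite divr_gt0.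
    by apply: nbhs_right_lt; rewrite divr_gt0.
  move=> [x' d] [/= xx' dr] y x'y.
  have xy : ball x r y.
    rewrite ballEmdist /=; move: xx'; rewrite ballEmdist /= => xx'.
    by apply: (le_lt_trans (metric_triangle x x' y)); lra.
  rewrite (rP _ xy) rP //; apply: le_ball xx'; lra.
move=> d /= d0 dP; exists (d / 2); first by rewrite divr_gt0.
move=> x y; apply: (dP (d / 2)) => //=; last by rewrite divr_gt0.
by rewrite sub0r normrN gtr0_norm ?divr_gt0 //; lra.
Qed.

End Labellings.

(** * Itineraries *)

Lemma expr_inj_modulus (R : realType) (lam : R[i]) (a b : nat) :
  modulus lam != 0 -> modulus lam != 1 -> (a < b)%N ->
  lam ^+ a != lam ^+ b.
Proof.
move=> lam0 lam1 ab; apply/eqP => /(congr1 modulus).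
have L0 : 0 <= modulus lam by rewrite -ler0c -modulusE.
rewrite !modulusX -[in X in _ = X](subnK (ltnW ab)) exprD => /esym/eqP.
rewrite -subr_eq0 -[X in _ - X]mul1r -mulrBl mulf_eq0 expf_eq0 (negbTE lam0) andbF.
rewrite orbF subr_eq0 pexpr_eq1 ?subn_gt0 // => /eqP lam1'.
by rewrite lam1' eqxx in lam1.
Qed.

Section Dynamics.
Variables (R : realType) (X : metricType R) (f : X -> X).
Hypotheses (compactX : compact [set: X])
  (tdX : totally_disconnected [set: X]) (cf : continuous f).

Lemma continuous_iter n : continuous (iter n f).
Proof.
elim: n => [|n IH] x; first exact: cvg_id.
by apply: continuous_comp; [exact: IH|exact: cf].
Qed.

Lemma loc_const_iter (T : Type) (phi : X -> T) n :
  loc_const phi -> loc_const (phi \o iter n f).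
Proof. by move=> cphi x; exact: (@continuous_iter n x _ (cphi (iter n f x))). Qed.

(** This is how finiteness of the range of phi is used below: finitely many
    labels determine its values. *)
Lemma loc_const_factor (T : Type) (phi : X -> T) : loc_const phi ->
  exists k (r : X -> 'I_k), forall x y, r x = r y -> phi x = phi y.
Proof.
move=> /(loc_const_uniform compactX) [delta delta0 deltaP].
have [k [r [_ rP]]] := fine_labelling compactX tdX delta0.
by exists k.+1, r => x y /rP; exact: deltaP.
Qed.

Lemma loc_const_bounded (phi : X -> R) : loc_const phi ->
  exists B, forall x, phi x <= B.
Proof.
move=> /loc_const_factor [k [r rP]].
have /choice [v vP] : forall i, exists v, forall x, r x = i -> phi x = v.
  move=> i; have [[x <-]|nx] := pselect (exists x, r x = i).
    by exists (phi x) => y; exact: rP.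
  by exists 0 => x xi; case: nx; exists x.
exists (\sum_i `|v i|) => x; rewrite (vP _ _ erefl) (bigD1 (r x)) //=.
by apply: (le_trans (ler_norm _)); rewrite lerDl sumr_ge0.
Qed.

Lemma loc_const_clopen (T : Type) (phi : X -> T) a :
  loc_const phi -> clopen (phi @^-1` [set a]).
Proof.
move=> cphi; have op (P : set T) : open (phi @^-1` P).
  by rewrite openE => x Px; apply: filterS (cphi x) => y /= ->.
by split => //; rewrite -[X in closed X]setCK; exact/open_closedC/(op (~` [set a])).
Qed.

Section Coding.
Variables (F : finType) (q : X -> F).
Hypothesis cq : loc_const q.

Definition code z : nat -> F := fun n => q (iter n f z).

Lemma code_iter z k n : code (iter k f z) n = code z (n + k).
Proof. by rewrite /code iterD. Qed.

(** A function of the whole itinerary that is locally constant on X depends on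
    finitely many letters, by compactness of X * X. *)
Lemma code_window_compact (T : Type) (psi : X -> T) : loc_const psi ->
  (forall x y, code x =1 code y -> psi x = psi y) ->
  exists N, forall x y, (forall n, (n <= N)%N -> code x n = code y n) ->
    psi x = psi y.
Proof.
move=> cpsi psiP.
have /compact_near_coveringP := compact_setX compactX compactX.
move=> /(_ nat \oo (fun N w => (forall n, (n <= N)%N -> code w.1 n = code w.2 n)
  -> psi w.1 = psi w.2)) [|N _ NP]; last first.
  exists N => x y xy; apply: (NP N _ (x, y)) => //=; exact: leqnn.
move=> [x y] _ /=.
have near_xy (U : set X) (V : set X) : nbhs x U -> nbhs y V ->
    nbhs (x, y) (U `*` V).
  by move=> xU yV; exists (U, V).
have [xy|xy] := pselect (psi x = psi y).
  exists ([set x' | psi x' = psi x] `*` [set y' | psi y' = psi y], setT).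
    by split; [apply: near_xy; exact: cpsi|exact: filterT].
  by move=> [[x' y'] N] [[/= -> ->] _].
have [n nP] : exists n, code x n <> code y n.
  by apply/existsNP => xy'; apply: xy; exact: psiP.
exists ([set x' | code x' n = code x n] `*` [set y' | code y' n = code y n],
  [set N | (n <= N)%N]).
  split; last exact: nbhs_infty_ge.
  by apply: near_xy; exact: (loc_const_iter n cq).
by move=> [[x' y'] N] [[/= x'n y'n] nN] /(_ n nN); rewrite x'n y'n.
Qed.

(** The itinerary of z seen as two-sided with time m as origin; it is meaningful
    on [- m, m], and absz only fills in the earlier coordinates. *)
Definition window m z : int -> F := fun i => code z (absz (m%:Z + i)).

(** Asking for central words on [- m, m] of points at time m, for every m, keeps
    only what can be extended arbitrarily far into the past. *)
Definition language : set (int -> F) :=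
  [set s | forall m, exists z, agree m s (window m z)].

Lemma language_subshift : subshift language.
Proof.
split => [s sL m|k s sL m].
  have [t tL st] := sL m; have [z tz] := tL m.
  by exists z => i im; rewrite st // tz.
have [z sz] := sL (m + absz k)%N.
exists (iter (absz (`|k| + k)) f z) => i im.
rewrite /shift sz ?/window; last by lia.
by rewrite code_iter; congr code; lia.
Qed.

(** If no n worked, points violating the equality at time n, viewed from time n,
    would accumulate at a point s of the language with s p <> s 0. *)
Lemma language_periodic p : (forall s, language s -> s p%:Z = s 0) ->
  exists n, forall z, code z (n + p) = code z n.
Proof.
move=> per; apply: contrapT => /forallNP nper.
have /choice [z zP] : forall n, exists z, code z (n + p) <> code z n.
  by move=> n; exact/existsNP.
have [s sP] := limit_point (fun n => window n (z n)).
have sL : language s.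
  move=> m; have [n mn sn] := sP m m.
  exists (iter (n - m) f (z n)) => i im.
  by rewrite sn // /window code_iter; congr code; lia.
have [n _ sn] := sP p 0%N.
apply: (zP n); move: (per s sL); rewrite !sn ?normr0 // /window.
by rewrite addr0.
Qed.

(** A point s of the language has no itinerary of a point of X as a whole, but
    since psi depends on N + 1 letters only, it can be evaluated at a point z
    whose itinerary follows s on a long window. *)
Lemma language_cohomological (lam : R[i]) :
  modulus lam != 0 -> modulus lam != 1 ->
  (forall phi : X -> R[i], loc_const phi ->
    exists2 psi : X -> R[i], loc_const psi &
      forall z, psi (f z) = lam * psi z + phi z) ->
  cohomological_solvable lam language.
Proof.
move=> lam0 lam1 solve phi m phim.
pose phiX z := phi (window m z).
have cphiX : loc_const phiX.
  move=> z; have : \forall y \near z, forall j : 'I_(m + m).+1, code y j = code z j.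
    by apply: filter_forall => j; exact: loc_const_iter.
  apply: filterS => y yz; apply: phim => i im.
  have im' : (absz (m%:Z + i)%R < (m + m).+1)%N by lia.
  exact: (yz (Ordinal im')).
have [psi cpsi psiS] := solve phiX cphiX.
have psi_code x y : code x =1 code y -> psi x = psi y.
  move=> xy; pose d n := psi (iter n f x) - psi (iter n f y).
  have dE n : d n = lam ^+ n * d 0%N.
    elim: n => [|n IH]; first by rewrite mul1r.
    rewrite exprS -mulrA -IH /d !iterS !psiS.
    have -> : phiX (iter n f x) = phiX (iter n f y).
      by congr phi; apply: funext => i; rewrite /window !code_iter xy.
    by ring.
  have [k [r rP]] := loc_const_factor cpsi.
  have [a [b [ab _ [rx ry]]]] :=
    nat_pigeonhole (fun n => (r (iter n f x), r (iter n f y))).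
  have dab : d a = d b by rewrite /d (rP _ _ rx) (rP _ _ ry).
  have : (lam ^+ a - lam ^+ b) * d 0%N = 0.
    by rewrite mulrBl -!dE dab subrr.
  move/eqP; rewrite mulf_eq0 subr_eq0 (negbTE (expr_inj_modulus lam0 lam1 ab)) /=.
  by rewrite subr_eq0 => /eqP.
have [N psiN] := code_window_compact cpsi psi_code.
have [B psiB] : exists B, forall z, modulus (psi z) <= B.
  apply: loc_const_bounded => x; apply: filterS (cpsi x) => y; exact: congr1.
(* At time N + 1 of z, that is at coordinate N + 1 - M = - m of s, where the
   datum phi of window m starts, the windows of psi at s and at shift 1 s both
   lie inside [- M, M]. *)
pose M := (m + N).+1.
have /choice [Psi PsiP] : forall s, exists c : R[i], language s ->
    exists2 z, agree M s (window M z) & c = psi (iter N.+1 f z).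
  move=> s; have [sL|nsL] := pselect (language s); last by exists 0.
  have [z sz] := sL M; exists (psi (iter N.+1 f z)) => _.
  by exists z.
exists Psi, B, M; split => [s sL|s t sL tL st|s sL].
- by have [z _ ->] := PsiP s sL.
- have [z sz ->] := PsiP s sL; have [w tw ->] := PsiP t tL.
  apply: psiN => n nN; rewrite !code_iter.
  have := st ((n + N.+1)%N%:Z - M%:Z); rewrite sz ?tw /window; try lia.
  have -> : absz (M%:Z + ((n + N.+1)%N%:Z - M%:Z)) = (n + N.+1)%N by lia.
  by apply; lia.
- have [z sz ->] := PsiP s sL.
  have [|w sw ->] := PsiP (shift 1 s).
    by have [_ Lshift] := language_subshift; exact: Lshift.
  have -> : phi s = phiX (iter N.+1 f z).
    apply: phim => i im; rewrite sz; last by lia.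
    by rewrite /window code_iter; congr code; lia.
  rewrite -psiS -iterS; apply: psiN => n nN; rewrite !code_iter.
  have := sw ((n + N.+1)%N%:Z - M%:Z); rewrite /shift sz ?/window; try lia.
  have -> : absz (M%:Z + ((n + N.+1)%N%:Z - M%:Z)) = (n + N.+1)%N by lia.
  have -> : absz (M%:Z + ((n + N.+1)%N%:Z - M%:Z + 1)) = (n + N.+2)%N by lia.
  by move=> <- //; lia.
Qed.

(** The points sharing their first n + p letters form the members of the
    partition. The word of f x is read off from that of x, its last letter being
    the letter n of x by periodicity. *)
Lemma periodic_dynamical_partition (eps : R) n p : (0 < p)%N ->
  (exists2 e : R, e < eps & forall x y, q x = q y -> mdist x y <= e) ->
  (forall z, code z (n + p) = code z n) ->
  exists P, dynamical_partition f eps P.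
Proof.
move=> p0 [e e_eps qe] per.
pose word z : {ffun 'I_(n + p) -> F} := [ffun i : 'I__ => code z i].
have wordP z w : word z = word w <-> forall i, (i < n + p)%N -> code z i = code w i.
  split => [zw i ip|zw]; last by apply/ffunP => i; rewrite !ffunE zw.
  by move/ffunP/(_ (Ordinal ip)): zw; rewrite !ffunE.
have cword : loc_const word.
  move=> z; have : \forall y \near z, forall i : 'I_(n + p), code y i = code z i.
    by apply: filter_forall => j; exact: loc_const_iter.
  by apply: filterS => y yz; apply/ffunP => i; rewrite !ffunE yz.
pose P := [set word @^-1` [set word z] | z in [set: X]].
exists P; split.
- apply: (@sub_finite_set _ _ [set word @^-1` [set w] | w in [set: {ffun 'I_(n + p) -> F}]]).
    by move=> _ [z _ <-]; exists (word z).
  exact/finite_image/finite_finset.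
- split.
  + by apply/seteqP; split => // z _; exists (word @^-1` [set word z]) => //; exists z.
  + move=> _ _ [z _ <-] [w _ <-] [y [/= yz yw]].
    by rewrite -yz -yw.
  + by move=> _ [z _ <-]; exists z.
- move=> _ [z _ <-]; split; first exact: loc_const_clopen.
  apply: (@le_lt_trans _ _ e%:E); last by rewrite lte_fin.
  apply: ge_ereal_sup => _ [x xz [y yz <-]]; rewrite lee_fin; apply: qe.
  have /wordP/(_ 0%N) : word x = word y by rewrite xz yz.
  by apply; lia.
- move=> _ [z _ <-]; exists (word @^-1` [set word (f z)]); first by exists (f z).
  move=> _ [y /= /wordP yz <-]; apply/wordP => i ip.
  have codeS x : code (f x) i = code x i.+1 by rewrite -addn1 -code_iter.
  rewrite !codeS; have [ip'|] := ltnP i.+1 (n + p); first exact: yz.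
  move=> ip'; have -> : i.+1 = (n + p)%N by lia.
  by rewrite !per; apply: yz; lia.
Qed.

End Coding.
End Dynamics.

(** * Homology in degree zero *)

(** A subspace S maximal among those containing W but not v is a hyperplane
    complementary to the line of v; the functional is the coordinate along v.
    The family [good] also admits the empty set, the union of the empty chain. *)
Lemma separating_functional (K : fieldType) (V : lmodType K) (W : set V) v :
  W 0 -> (forall a u w, W u -> W w -> W (a *: u + w)) -> ~ W v ->
  exists T : dual V, (forall w, W w -> dual_fun T w = 0) /\ dual_fun T v = 1.
Proof.
move=> W0 Wlin Wv.
pose good (S : set V) := [/\ ~ S v, S !=set0 -> W `<=` S &
  forall a u w, S u -> S w -> S (a *: u + w)].
have [|S [[Sv SW Slin] Smax]] := @Zorn_bigcup V good.
  move=> C Cgood Ctot; split => [[S CS Sv]|[x [S CS Sx]]|a u w [S CS Su] [S' CS' Sw]].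
  - by have [] := Cgood S CS.
  - have [_ WS _] := Cgood S CS; move=> w Ww; exists S => //.
    by apply: WS => //; exists x.
  - have [_ _ Slin] := Cgood S CS; have [_ _ Slin'] := Cgood S' CS'.
    have [SS|SS] := Ctot S S' CS CS'.
      by exists S' => //; apply: Slin' => //; exact: SS.
    by exists S => //; apply: Slin => //; exact: SS.
have WS : W `<=` S.
  apply: SW; apply/set0P/eqP => S0; apply: (Smax W); last by split => // _ w.
  by rewrite S0; split; [exact: sub0set|move=> /(_ 0 W0)].
have S0 : S 0 by exact: WS.
have SZ a u : S u -> S (a *: u) by move=> Su; rewrite -[_ *: _]addr0; exact: Slin.
have coordP u : exists a, S (u - a *: v).
  have [Su|Su] := pselect (S u); first by exists 0; rewrite scale0r subr0.
  pose S' := [set x | exists b, S (x - b *: u)].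
  have SS' : S `<=` S' by move=> x Sx; exists 0; rewrite scale0r subr0.
  have S'u : S' u by exists 1; rewrite scale1r subrr.
  have [b Sb] : S' v.
    apply: contrapT => S'v; apply: (Smax S').
      rewrite properEneq; split => //; apply/eqP => SE.
      by apply: Su; rewrite SE.
    split => // [_ w /WS /SS' //|a x y [b xb] [c yc]].
    exists (a * b + c); have := Slin a _ _ xb yc.
    by rewrite scalerBr scalerA addrACA -opprD -scalerDl.
  have b0 : b != 0.
    by apply/eqP => b0; apply: Sv; move: Sb; rewrite b0 scale0r subr0.
  exists b^-1; have := SZ (- b^-1) _ Sb.
  by rewrite scalerBr scalerA mulNr mulVf // scaleN1r opprK addrC scaleNr.
have [c cP] := choice coordP.
have coord_unique u a : S (u - a *: v) -> c u = a.
  move=> ua; apply/eqP; apply: contrapT => /negP ca; apply: Sv.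
  have := SZ (c u - a)^-1 _ (Slin (-1) _ _ (cP u) ua).
  rewrite scaleN1r opprB addrA subrK -scalerBl scalerA mulVf ?scale1r //.
  by rewrite subr_eq0.
have c_linear : linear (c : V -> K^o).
  move=> a u w; apply: coord_unique.
  have := Slin a _ _ (cP u) (cP w).
  by rewrite scalerBr scalerA addrACA -opprD -scalerDl.
pose T : {linear V -> K^o} :=
  HB.pack (c : V -> K^o) (GRing.isLinear.Build K V K^o *:%R c c_linear).
exists T; split => [w Ww|]; apply: coord_unique.
  by rewrite scale0r subr0; exact: WS.
by rewrite scale1r subrr.
Qed.

Section CechHomology.
Variables (R : realType) (X : metricType R) (f : X -> X) (cf : continuous f).
Implicit Types (phi psi : cech_coh0 X R[i]) (lam : R[i]).

Lemma coh0_loc_const phi : loc_const phi.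
Proof. by case: phi => phi /= /asboolP. Qed.

Lemma dual_fun_push (T : cech_hom0 X R[i]) phi :
  dual_fun (hom0_push R[i] cf T) phi = dual_fun T (coh0_pull cf phi).
Proof. by []. Qed.

(** A function outside the range of coh0_pull - lam would be separated from it
    by a functional, which is an eigenvector of the push-forward. *)
Lemma not_eigenvalue_solve lam :
  ~ lin_eigenvalue (hom0_push R[i] cf) lam ->
  forall phi : X -> R[i], loc_const phi ->
    exists2 psi : X -> R[i], loc_const psi &
      forall z, psi (f z) = lam * psi z + phi z.
Proof.
move=> nlam phi cphi.
have phiL : (phi : X -> R[i]^o) \in @lconst X R[i] by apply/asboolP.
pose W := [set w : cech_coh0 X R[i] | exists psi, coh0_pull cf psi - lam *: psi = w].
have [[psi psiE]|nW] := pselect (W (CechCoh0 phiL)).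
  exists psi; first exact: coh0_loc_const.
  move=> z; have /(congr1 (fun g : cech_coh0 X R[i] => (g : X -> R[i]^o) z)) := psiE.
  by move=> /= <-; rewrite addrC subrK.
have [||T [TW Tphi]] := separating_functional _ _ nW.
- by exists 0; rewrite linear0 scaler0 subr0.
- move=> a _ _ [u <-] [w <-]; exists (a *: u + w).
  rewrite linearP scalerDr scalerBr opprD addrACA; congr (_ + _ + _).
  by rewrite !scalerA mulrC.
case: nlam; exists T.
  apply/eqP => T0; move/eqP: Tphi; rewrite T0 /= eq_sym.
  by rewrite (negbTE (oner_neq0 _)).
apply: dual_ext => psi; rewrite dual_fun_push.
have := TW _ (ex_intro _ psi erefl).
rewrite /dual_fun linearB linearZ => /eqP.
by rewrite subr_eq0 => /eqP.
Qed.

Lemma dual_fun_iter lam (T : cech_hom0 X R[i]) n phi :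
  hom0_push R[i] cf T = lam *: T ->
  dual_fun T (iter n (coh0_pull cf) phi) = lam ^+ n * dual_fun T phi.
Proof.
move=> TE; elim: n => [|n IH]; first by rewrite mul1r.
by rewrite iterS -dual_fun_push TE exprS -mulrA -IH.
Qed.

Lemma coh0_pull_iter n phi z :
  (iter n (coh0_pull cf) phi : X -> R[i]^o) z = phi (iter n f z).
Proof. by elim: n z => [//|n IH] z; rewrite iterS /= IH -iterSr. Qed.

(** The image members define a self-map of a finite set, two of whose iterates
    coincide. *)
Lemma dynamical_partition_iterates (eps : R) P : dynamical_partition f eps P ->
  exists a b, (a < b)%N /\ forall z, mdist (iter a f z) (iter b f z) < eps.
Proof.
move=> [/finite_fsetP [D PD] [Pcov _ _] Psmall Pnext].
have /choice [next nextP] : forall U, exists U', P U -> P U' /\ f @` U `<=` U'.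
  move=> U; have [PU|nPU] := pselect (P U); last by exists U.
  by have [U' PU' fU] := Pnext U PU; exists U'.
have Piter n U : P U -> P (iter n next U).
  by move=> PU; elim: n => //= n IH; have [] := nextP _ IH.
have iterP n U z : P U -> U z -> iter n next U (iter n f z).
  move=> PU Uz; elim: n => //= n IH; have [_] := nextP _ (Piter n U PU).
  by apply; exists (iter n f z).
pose h n : {ffun D -> 'I_(size (enum_fset D)).+1} :=
  [ffun U => inord (index (iter n next (val U)) (enum_fset D))].
have [a [b [ab _ hab]]] := nat_pigeonhole h.
exists a, b; split => // z.
have [U PU Uz] : cover P id z by rewrite Pcov.
have UD : U \in D by move: PU; rewrite PD.
have memD n : iter n next U \in enum_fset D by move: (Piter n U PU); rewrite PD.
have UE : iter a next U = iter b next U.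
  move/ffunP/(_ [` UD]%fset)/(congr1 val): hab.
  rewrite !ffunE /= !inordK ?ltnS ?index_size // => /index_inj; exact.
have [_] := Psmall _ (Piter b U PU).
rewrite -lte_fin; apply: le_lt_trans; apply: ereal_sup_ubound => /=.
exists (iter a f z); first by rewrite -UE; exact: iterP.
by exists (iter b f z) => //; exact: iterP.
Qed.

End CechHomology.

Theorem theorem2 (R : realType) (X : metricType R) (f : X -> X)
    (compactX : compact [set: X])
    (tdX : totally_disconnected [set: X])
    (cf : continuous f) :
  ((exists lam : R[i], [/\ `|lam| != 0, `|lam| != 1 &
      ~ lin_eigenvalue (hom0_push R[i] cf) lam])
   <-> (forall lam : R[i], `|lam| != 0 -> `|lam| != 1 ->
          ~ lin_eigenvalue (hom0_push R[i] cf) lam))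
  /\
  ((forall lam : R[i], `|lam| != 0 -> `|lam| != 1 ->
      ~ lin_eigenvalue (hom0_push R[i] cf) lam)
   <-> (forall eps : R, 0 < eps ->
          exists P : set (set X), dynamical_partition f eps P)).
Proof.
have modulus_neq0 (lam : R[i]) : `|lam| != 0 -> modulus lam != 0.
  by rewrite modulusE; apply: contra_neq => ->.
have modulus_neq1 (lam : R[i]) : `|lam| != 1 -> modulus lam != 1.
  by rewrite modulusE; apply: contra_neq => ->.
have partitions_of_one : (exists lam : R[i], [/\ `|lam| != 0, `|lam| != 1 &
      ~ lin_eigenvalue (hom0_push R[i] cf) lam]) ->
    forall eps : R, 0 < eps -> exists P, dynamical_partition f eps P.
  move=> [lam [/modulus_neq0 lam0 /modulus_neq1 lam1 nlam]] eps eps0.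
  have eps20 : 0 < eps / 2 by rewrite divr_gt0.
  have [k [q [cq qP]]] := fine_labelling compactX tdX eps20.
  have Ylam := language_cohomological compactX tdX cf cq lam0 lam1
    (not_eigenvalue_solve nlam).
  have [p p0 Yper] :=
    cohomological_periodic (language_subshift f q) Ylam lam0 lam1.
  have [n per] := language_periodic Yper.
  apply: (periodic_dynamical_partition cf cq p0 _ per).
  exists (eps / 2); first by lra.
  by move=> x y /qP /ltW.
have none_of_partitions : (forall eps : R, 0 < eps ->
      exists P, dynamical_partition f eps P) ->
    forall lam : R[i], `|lam| != 0 -> `|lam| != 1 ->
      ~ lin_eigenvalue (hom0_push R[i] cf) lam.
  move=> parts lam /modulus_neq0 lam0 /modulus_neq1 lam1 [T T0 TE].
  move/eqP: T0; apply; apply: dual_ext => phi; rewrite [RHS]/=.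
  have [delta delta0 deltaP] := loc_const_uniform compactX (@coh0_loc_const _ _ phi).
  have [P /dynamical_partition_iterates [a [b [ab close]]]] := parts _ delta0.
  have pull_ab : iter a (coh0_pull cf) phi = iter b (coh0_pull cf) phi.
    apply: val_inj; apply: funext => z /=.
    by rewrite !coh0_pull_iter; exact: deltaP.
  have /eqP : (lam ^+ a - lam ^+ b) * dual_fun T phi = 0.
    by rewrite mulrBl -!(dual_fun_iter _ _ TE) pull_ab subrr.
  rewrite mulf_eq0 subr_eq0 (negbTE (expr_inj_modulus lam0 lam1 ab)) /=.
  by move/eqP.
have one_of_none : (forall lam : R[i], `|lam| != 0 -> `|lam| != 1 ->
      ~ lin_eigenvalue (hom0_push R[i] cf) lam) ->
    exists lam : R[i], [/\ `|lam| != 0, `|lam| != 1 &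
      ~ lin_eigenvalue (hom0_push R[i] cf) lam].
  move=> none; have n0 : `|2 : R[i]| != 0 by rewrite normr_nat pnatr_eq0.
  have n1 : `|2 : R[i]| != 1 by rewrite normr_nat (eqr_nat _ 2 1).
  by exists 2; split => //; exact: none.
split; split => //.
- by move=> /partitions_of_one /none_of_partitions.
- by move=> /one_of_none /partitions_of_one.
Qed.
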